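(* Let $\lambda>0$ be a constant and let $\{m=m(n)\}_n$ be a sequence of integers, $m(n)\in\{0,\ldots,n-1\}$, such that $m\to\infty$ and $\frac{n-m}{\sqrt n}\to\sqrt{2\lambda}$ as $n\to\infty$. Let $\lambda_n=\sum_{i=m+1}^n\left(1-\frac in\right)$. Then the error $d_{\mathrm{TV}}(\mathcal D(\widetilde W_{n,m}),\mathrm{Po}(\lambda_n))$ is of order $\sum_{i=m+1}^n\left(1-\frac in\right)^2$ (bounded above and below by positive constant multiples of it for all large $n$). In fact, for all $n$ such that $\min_{m+1\le i\le n}\frac in\ge\frac34$, $$\frac15\left(\prod_{i=m+1}^n\frac in\right)\sum_{i=m+1}^n\left(1-\frac in\right)^2\le d_{\mathrm{TV}}(\mathcal D(\widetilde W_{n,m}),\mathrm{Po}(\lambda_n))\le2\sum_{i=m+1}^n\left(1-\frac in\right)^2.$$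
   Context: Coupon collector's waiting time: coupons are drawn independently and uniformly at random with replacement from $n\ge2$ distinct coupons, and $W_{n,m}$ is the number of draws until $n-m$ distinct coupons have been collected for the first time. The shifted waiting time is $\widetilde W_{n,m}=W_{n,m}-(n-m)$; equivalently it is distributed as $\sum_{i=m+1}^n\widetilde X_{n,i}$ with independent $\widetilde X_{n,i}$ satisfying $\mathbf P(\widetilde X_{n,i}=j)=(1-\frac in)^j\frac in$, $j=0,1,2,\ldots$. $\mathcal D(X)$ is the distribution of $X$, $\mathrm{Po}(\lambda)$ the Poisson distribution with mean $\lambda$ ($\mathrm{Po}(0)$ being the point mass at $0$), and $d_{\mathrm{TV}}(\mu,\nu)=\sup_{A\subset\{0,1,2,\ldots\}}|\mu(A)-\nu(A)|$. *)

(* Defs.v *)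
From mathcomp Require Import all_boot all_order all_algebra finmap.
From mathcomp Require Import all_classical all_reals all_analysis.

Set Implicit Arguments.
Unset Strict Implicit.
Unset Printing Implicit Defensive.
Import Order.TTheory GRing.Theory Num.Theory.
Import numFieldNormedType.Exports.
Local Open Scope classical_set_scope.
Local Open Scope ring_scope.

(* Random variables with values in the finite set 'I_n, which carries the
   discrete sigma-algebra: every subset of 'I_n has a measurable preimage.
   [X k] is the coupon obtained at the (k + 1)-st draw. *)
Definition mutually_independent (R : realType) d (T : measurableType d)
    (P : probability T R) n (X : nat -> T -> 'I_n) : Prop :=
  forall (J : {fset nat}) (A : nat -> set 'I_n),
    P (\bigcap_(j in [set` J]) (X j @^-1` A j)) =
    (\prod_(j <- J) P (X j @^-1` A j))%E.

Definition coupon_draws (R : realType) d (T : measurableType d)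
    (P : probability T R) n (X : nat -> T -> 'I_n) : Prop :=
  [/\ forall k (A : set 'I_n), measurable (X k @^-1` A),
      forall k (i : 'I_n), P (X k @^-1` [set i]) = (n%:R^-1)%:E &
      mutually_independent P X].

Definition collected n (x : nat -> 'I_n) (k : nat) : {set 'I_n} :=
  [set x (val j) | j : 'I_k]%SET.

(* The first k such that r distinct coupons occur among the first k draws.
   The value 0 when there is no such k is a dummy: for independent uniform
   draws and r <= n this happens with probability 0, so the distribution is
   not affected. *)
Definition first_time n (x : nat -> 'I_n) (r : nat) : nat :=
  if pselect (exists k, r <= #|collected x k|)%N is left h then ex_minn h
  else 0%N.

Definition waiting_time T n (X : nat -> T -> 'I_n) (m : nat) (w : T) : nat :=
  first_time (fun k => X k w) (n - m).

(* The subtraction of n - m is never truncated, except at the dummy value 0: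
   at least n - m draws are needed. *)
Definition shifted_waiting_time T n (X : nat -> T -> 'I_n) (m : nat) (w : T) :
    nat :=
  (waiting_time X m w - (n - m))%N.

Definition dTV (R : realType) (mu nu : set nat -> \bar R) : R :=
  sup [set `|fine (mu A) - fine (nu A)| | A in [set: set nat]].

(* The last argument of [poisson_prob] is not used by its definition;
   [poisson_prob 0 _] is the point mass at 0. *)
Definition Po (R : realType) (rate : R) : set nat -> \bar R :=
  poisson_prob rate 0.

Definition lambda_ (R : realType) (n m : nat) : R :=
  \sum_(m.+1 <= i < n.+1) (1 - i%:R / n%:R).

Definition sum_sq (R : realType) (n m : nat) : R :=
  \sum_(m.+1 <= i < n.+1) (1 - i%:R / n%:R) ^+ 2.

Definition poisson_error (R : realType) d (T : measurableType d)
    (P : probability T R) n (X : nat -> T -> 'I_n) (m : nat) : R :=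
  dTV (pushforward P (shifted_waiting_time X m)) (Po (lambda_ R n m)).

(* Main.v *)
(* With r_l = l / n, the shifted waiting time for n - m coupons is distributed
   as a sum of independent geometric variables with failure probabilities r_l,
   l < n - m. For one summand, the Poisson weights exceed the geometric ones by
   at most r_l ^ 2 in total on {0, 1}, and the Poisson mass elsewhere is at most
   r_l ^ 2; such errors add up under convolution, whence the upper bound.
   For the lower bound it suffices to compare the masses of {0}: exp (- sum r_l)
   exceeds prod (1 - r_l) by a factor at least 1 + (sum r_l ^ 2) / 5. *)
Require Import Defs.
From mathcomp Require Import all_boot all_order all_algebra finmap.
From mathcomp Require Import all_classical all_reals all_analysis.
From HB Require Import structures.
From mathcomp Require Import ring lra zify.

Set Implicit Arguments.
Unset Strict Implicit.
Unset Printing Implicit Defensive.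
Import Order.TTheory GRing.Theory Num.Theory.
Import numFieldNormedType.Exports.
Local Open Scope classical_set_scope.
Local Open Scope ring_scope.

(** * Total variation distance between probability measures on the naturals *)

Section probability_nat.
Variable R : realType.

Lemma measure_natE (mu : {measure set nat -> \bar R}) (A : set nat) :
  mu A = (\sum_(k <oo | k \in A) mu [set k])%E.
Proof.
rewrite -measure_bigcup//; first by rewrite bigcup_imset1 image_id.
by move=> i j _ _ [k [/= <-]].
Qed.

Lemma sum_set1_le_measure (mu : {measure set nat -> \bar R}) (A : set nat) K :
  (\sum_(0 <= k < K | k \in A) mu [set k] <= mu A)%E.
Proof.
by rewrite [leRHS]measure_natE; apply: nneseries_lim_ge => k _ _; exact: measure_ge0.
Qed.

(** Both total masses are 1, so passing to the complement of a set flips the sign of the deviation.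
    It is therefore enough to bound the deviations in one direction, and these are dominated by the
    positive parts of the pointwise differences. *)
Lemma dTV_le (mu nu : probability nat R) (eps : R) :
  (forall K, \sum_(0 <= k < K) Num.max 0 (fine (nu [set k]) - fine (mu [set k]))
     <= eps) ->
  dTV mu nu <= eps.
Proof.
move=> hK.
have one_sided A : fine (nu A) - fine (mu A) <= eps.
  rewrite lerBlDl -lee_fin EFinD !fineK ?fin_num_measure//.
  rewrite (measure_natE nu); apply: lime_le.
    by apply: is_cvg_nneseries => k _ _; exact: measure_ge0.
  apply: nearW => K.
  have muK := sum_set1_le_measure mu A K.
  have epsK := hK K; rewrite -lee_fin in epsK.
  apply: le_trans (leeD muK epsK).
  rewrite -sumEFin big_mkcond [X in (_ <= X + _)%E]big_mkcond -big_split/=.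
  apply: lee_sum => k _.
  rewrite -[nu _]fineK ?fin_num_measure// -[mu _]fineK ?fin_num_measure//.
  case: ifP => _; last by rewrite add0e lee_fin le_max lexx.
  by rewrite -EFinD lee_fin -lerBlDl le_max lexx orbT.
have sideC (P : probability nat R) A : fine (P (~` A)) = 1 - fine (P A).
  by rewrite probability_setC// fineB ?fin_num_measure.
apply: ge_sup; first by exists `|fine (mu set0) - fine (nu set0)|; exists set0.
move=> _ [A _ <-]; rewrite ler_norml; apply/andP; split.
  by rewrite lerNl opprB one_sided.
by have := one_sided (~` A); rewrite !sideC; lra.
Qed.

Lemma ler_dTV (mu nu : probability nat R) (A : set nat) :
  fine (nu A) - fine (mu A) <= dTV mu nu.
Proof.
have fine01 (P : probability nat R) B : 0 <= fine (P B) <= 1.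
  rewrite fine_ge0 ?measure_ge0//= -lee_fin fineK ?fin_num_measure//.
  exact: probability_le1.
apply: (@le_trans _ _ `|fine (mu A) - fine (nu A)|).
  by rewrite distrC ler_norm.
apply: ub_le_sup; last by exists A.
(* The deviations are bounded by 1, so [sup] is a genuine supremum here and not a default value. *)
exists 1 => _ [B _ <-]; rewrite ler_norml.
by have := fine01 mu B; have := fine01 nu B; lra.
Qed.

End probability_nat.

(** * Convolution of weights on the naturals *)

Definition conv (R : realType) (f g : nat -> R) (k : nat) : R :=
  \sum_(i < k.+1) f i * g (k - i)%N.

Definition geometric_pmf (R : realType) (r : R) (k : nat) : R := r ^+ k * (1 - r).

(* Unlike [poisson_pmf], this is the point mass at 0 when [r = 0]. *)
Definition poisson_weight (R : realType) (r : R) (k : nat) : R :=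
  r ^+ k / k`!%:R * expR (- r).

Fixpoint geometric_sum_pmf (R : realType) (r : nat -> R) (N : nat) : nat -> R :=
  if N is M.+1 then conv (geometric_pmf (r M)) (geometric_sum_pmf r M)
  else fun k => (k == 0%N)%:R.

Section convolution.
Variable R : realType.
Implicit Types f g u v : nat -> R.

Lemma conv_ge0 f g k : (forall i, 0 <= f i) -> (forall i, 0 <= g i) ->
  0 <= conv f g k.
Proof. by move=> f0 g0; apply: sumr_ge0 => i _; apply: mulr_ge0. Qed.

Lemma sum_conv f g K : \sum_(k < K) conv f g k =
  \sum_(i < K) f i * \sum_(j < (K - i)%N) g j.
Proof.
elim: K => [|K IHK]; first by rewrite !big_ord0.
rewrite big_ord_recr/= IHK /conv big_ord_recr/= [RHS]big_ord_recr/=.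
rewrite subnn subSnn big_ord1 addrA; congr +%R.
rewrite -big_split/=; apply: eq_bigr => i _.
by rewrite subSn ?(ltnW (ltn_ord i))// big_ord_recr/= mulrDr.
Qed.

Lemma ler_sum_ord g j K : (forall i, 0 <= g i) -> (j <= K)%N ->
  \sum_(i < j) g i <= \sum_(i < K) g i.
Proof.
move=> g0 jK; rewrite -(subnKC jK) big_split_ord/= lerDl.
exact: sumr_ge0.
Qed.

Lemma sum_conv_le f g K a b : (forall i, 0 <= f i) -> (forall i, 0 <= g i) ->
  0 <= b -> \sum_(i < K) f i <= a -> \sum_(i < K) g i <= b ->
  \sum_(k < K) conv f g k <= a * b.
Proof.
move=> f0 g0 b0 fa gb; rewrite sum_conv.
apply: (@le_trans _ _ (\sum_(i < K) f i * b)); last first.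
  by rewrite -mulr_suml ler_wpM2r.
apply: ler_sum => i _; apply: ler_wpM2l => //.
exact: le_trans (ler_sum_ord g0 (leq_subr _ _)) gb.
Qed.

(** The geometric weights have generating function (1 - r) / (1 - r z). Clearing the denominator
    turns convolution with them into this first-order recursion, which determines [u]. *)
Lemma conv_geometric (r : R) f u :
  u 0%N = (1 - r) * f 0%N ->
  (forall k, u k.+1 = r * u k + (1 - r) * f k.+1) ->
  u =1 conv (geometric_pmf r) f.
Proof.
move=> u0 uS; elim=> [|k IHk].
  by rewrite /conv big_ord1 subn0 u0 /geometric_pmf expr0 mul1r.
rewrite uS IHk /conv [RHS]big_ord_recl/= subn0 addrC; congr +%R.
  by rewrite /geometric_pmf expr0 mul1r.
rewrite mulr_sumr; apply: eq_bigr => i _.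
by rewrite /bump/= subSS /geometric_pmf exprS !mulrA.
Qed.

(** The binomial theorem for [(r + s) ^+ k], divided by k!. *)
Lemma conv_poisson (r s : R) k :
  poisson_weight (r + s) k = conv (poisson_weight r) (poisson_weight s) k.
Proof.
rewrite /poisson_weight addrC exprDn opprD expRD !mulr_suml.
apply: eq_bigr => i _.
have ik : (i <= k)%N by rewrite -ltnS.
have f0 j : (j`!%:R : R) != 0 by rewrite pnatr_eq0 -lt0n fact_gt0.
have -> : (k`!%:R : R) = 'C(k, i)%:R * i`!%:R * (k - i)`!%:R.
  by rewrite -!natrM -mulnA bin_fact.
rewrite -mulr_natr; field.
by rewrite !f0/= pnatr_eq0 -lt0n bin_gt0.
Qed.

End convolution.

(** * Comparison of geometric and Poisson weights *)

Section geometric_poisson.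
Variable R : realType.
Implicit Types (r : R) (rs : nat -> R).

Lemma geometric_pmf_ge0 r k : 0 <= r <= 1 -> 0 <= geometric_pmf r k.
Proof. by move=> /andP[r0 r1]; rewrite mulr_ge0 ?exprn_ge0 ?subr_ge0. Qed.

Lemma sum_geometric_pmf r K : \sum_(k < K) geometric_pmf r k = 1 - r ^+ K.
Proof.
elim: K => [|K IHK]; first by rewrite big_ord0 expr0 subrr.
by rewrite big_ord_recr/= IHK /geometric_pmf exprS; ring.
Qed.

Lemma poisson_weight_ge0 r k : 0 <= r -> 0 <= poisson_weight r k.
Proof. by move=> r0; rewrite mulr_ge0 ?expR_ge0// divr_ge0// exprn_ge0. Qed.

Lemma poisson_prob1 r k : 0 <= r ->
  poisson_prob r 0 [set k] = (poisson_weight r k)%:E.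
Proof.
rewrite le_eqVlt => /predU1P[<-|r0]; rewrite /poisson_prob /poisson_weight.
  rewrite ltxx diracE oppr0 expR0 mulr1; case: k => [|k].
    by rewrite expr0 fact0 divr1 mem_set.
  by rewrite expr0n/= mul0r memNset.
by rewrite r0 esum_set1 /poisson_pmf r0// lee_fin poisson_weight_ge0// ltW.
Qed.

Lemma sum_poisson_weight_le1 r K : 0 <= r -> \sum_(k < K) poisson_weight r k <= 1.
Proof.
move=> r0; rewrite -(big_mkord xpredT (poisson_weight r)) -lee_fin -sumEFin.
under eq_bigr do rewrite -poisson_prob1//.
apply: le_trans (probability_le1 (poisson_prob r 0) (measurableT : measurable [set: nat])).
have := sum_set1_le_measure (poisson_prob r 0) [set: nat] K.
by rewrite [X in (X <= _)%E -> _](eq_bigl xpredT)// => k; rewrite mem_set.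
Qed.

(** With e = exp(-r), the excess is [e - (1 - r)] at 0 and r times that at 1. From 2 on it is at
    most the Poisson tail, hence at most [1 - e * (1 + r)] in total. *)
Lemma poisson_geometric_excess r K : 0 <= r <= 1 ->
  \sum_(k < K) Num.max 0 (poisson_weight r k - geometric_pmf r k) <= 2 * r ^+ 2.
Proof.
move=> /andP[r0 r1]; pose u k := Num.max 0 (poisson_weight r k - geometric_pmf r k).
(* Two extra terms allow the indices 0 and 1 to be split off for every [K]. *)
apply: (@le_trans _ _ (\sum_(k < K.+2) u k)).
  by apply: (@ler_sum_ord _ u) => [i|]; rewrite ?le_max ?lexx// ltnW.
rewrite {}/u.
have := sum_poisson_weight_le1 K.+2 r0.
rewrite !big_ord_recl/= /bump/= !add1n.
set S := \sum_(i < K) _; set S' := \sum_(i < K) _ => S1.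
have SS' : S' <= S.
  apply: ler_sum => i _; rewrite ge_max poisson_weight_ge0// lerBlDr lerDl.
  by rewrite geometric_pmf_ge0// r0.
move: S1; rewrite /poisson_weight /geometric_pmf !expr0 !expr1 !fact0 !mul1r !divr1.
set e := expR (- r) => S1.
have e1 : 1 - r <= e by exact: expR_ge1Dx.
have e2 : e * (1 + r) <= 1.
  by rewrite /e expRN mulrC ler_pdivrMr ?expR_gt0// mul1r expR_ge1Dx.
rewrite !max_r; nra.
Qed.

(* Writing [p], [q] for the pmfs of the two sums of the first N terms and [a],
   [b] for those of the next terms, [a * p - b * q = (a - b) * p + b * (p - q)],
   so that positive parts of the errors add up. *)
Lemma poisson_geometric_sum_excess rs N K :
  (forall l, (l < N)%N -> 0 <= rs l <= 1) ->
  \sum_(k < K) Num.max 0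
    (poisson_weight (\sum_(l < N) rs l) k - geometric_sum_pmf rs N k)
    <= 2 * \sum_(l < N) rs l ^+ 2.
Proof.
elim: N => [|N IHN] rs01.
  rewrite !big_ord0 mulr0 big1// => k _ /=.
  rewrite /poisson_weight oppr0 expR0 mulr1.
  case: k => -[|k] /= _; first by rewrite expr0 fact0 divr1 subrr maxxx.
  by rewrite expr0n/= mul0r subrr maxxx.
have rs01' l : (l < N)%N -> 0 <= rs l <= 1 by move=> lN; rewrite rs01// ltnS ltnW.
have := rs01 N (ltnSn _); set r := rs N => r01.
have [r0 r1] := andP r01.
rewrite !big_ord_recr/= mulrDr -/r.
set L := \sum_(l < N) rs l.
have L0 : 0 <= L by apply: sumr_ge0 => l _; have /andP[] := rs01' l (ltn_ord l).
pose p := poisson_weight L; pose q := geometric_sum_pmf rs N.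
pose a := poisson_weight r; pose b := geometric_pmf r.
pose u k := Num.max 0 (a k - b k); pose v k := Num.max 0 (p k - q k).
have u0 k : 0 <= u k by rewrite le_max lexx.
have v0 k : 0 <= v k by rewrite le_max lexx.
have p0 k : 0 <= p k by exact: poisson_weight_ge0.
have b0 k : 0 <= b k by exact: geometric_pmf_ge0.
apply: (@le_trans _ _ (\sum_(k < K) (conv u p k + conv b v k))).
  apply: ler_sum => k _.
  rewrite ge_max addr_ge0 ?conv_ge0//= addrC conv_poisson.
  rewrite -/(conv b q k) /conv -sumrB -big_split/=.
  apply: ler_sum => i _.
  rewrite (_ : _ - _ = (a i - b i) * p (k - i)%N + b i * (p (k - i)%N - q (k - i)%N)).
    by rewrite lerD// ?ler_wpM2r ?ler_wpM2l// le_max lexx orbT.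
  by rewrite mulrBl mulrBr addrA subrK.
(* In each convolution the factor that is not an error has mass at most 1, so convolving does not
   enlarge the error. *)
rewrite big_split/= addrC lerD//.
  rewrite -[leRHS]mul1r; apply: sum_conv_le => //.
  - by rewrite mulr_ge0// sumr_ge0// => l _; rewrite sqr_ge0.
  - by rewrite sum_geometric_pmf lerBlDr lerDl exprn_ge0.
  - exact: IHN.
rewrite -[leRHS]mulr1; apply: sum_conv_le => //.
- exact: poisson_geometric_excess.
- exact: sum_poisson_weight_le1.
Qed.

Lemma geometric_sum_pmf0 rs N :
  geometric_sum_pmf rs N 0 = \prod_(l < N) (1 - rs l).
Proof.
elim: N => [|N IHN]; first by rewrite big_ord0.
by rewrite big_ord_recr/= -IHN /conv big_ord1 subnn /geometric_pmf expr0 mul1r mulrC.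
Qed.

(** Squaring the tangent bound at r / 2 gives [1 - r + r ^+ 2 / 4], a quadratic gain over [1 - r]
    that leaves room for the constant 1/5. *)
Lemma expRN_ge r : 0 <= r <= 1 -> (1 - r) * (1 + r ^+ 2 / 5) <= expR (- r).
Proof.
move=> /andP[r0 r1].
have h : 1 - r / 2 <= expR (- (r / 2)) by exact: expR_ge1Dx.
have -> : expR (- r) = expR (- (r / 2)) ^+ 2.
  by rewrite expr2 -expRD; congr expR; field.
apply: (@le_trans _ _ ((1 - r / 2) ^+ 2)); first nra.
by rewrite ler_pXn2r ?nnegrE ?expR_ge0//; lra.
Qed.

Lemma prod_expRN_ge rs N : (forall l, (l < N)%N -> 0 <= rs l <= 1) ->
  (\prod_(l < N) (1 - rs l)) * (1 + (\sum_(l < N) rs l ^+ 2) / 5)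
    <= expR (- \sum_(l < N) rs l).
Proof.
elim: N => [|N IHN] rs01; first by rewrite !big_ord0 oppr0 expR0 mul0r addr0 mulr1.
have rs01' l : (l < N)%N -> 0 <= rs l <= 1 by move=> lN; rewrite rs01// ltnS ltnW.
rewrite !big_ord_recr/= opprD expRD.
have {IHN} := IHN rs01'; have := expRN_ge (rs01 N (ltnSn _)).
have := rs01 N (ltnSn _); set r := rs N => /andP[r0 r1].
set p := \prod_(l < N) _; set s := \sum_(l < N) _ ^+ 2.
have p0 : 0 <= p.
  by apply: prodr_ge0 => l _; have /andP[_] := rs01' l (ltn_ord l); rewrite subr_ge0.
have s0 : 0 <= s by apply: sumr_ge0 => l _; exact: sqr_ge0.
set e1 := expR _; set e2 := expR _ => h1 h2.
apply: le_trans (ler_pM _ _ h2 h1).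
(* Multiplying the two gains produces, besides their sum, only a nonnegative cross term, which is
   dropped. *)
- rewrite -subr_ge0; set w := (X in 0 <= X).
  have -> : w = p * (1 - r) * (s * r ^+ 2 / 25) by rewrite /w; field.
  by rewrite !mulr_ge0 ?subr_ge0 ?sqr_ge0.
- by rewrite mulr_ge0// addr_ge0// divr_ge0.
- by rewrite mulr_ge0 ?subr_ge0// addr_ge0// divr_ge0// sqr_ge0.
Qed.

End geometric_poisson.

(** * Words of draws, counted by their number of distinct coupons *)

Fixpoint draws n (x : nat -> 'I_n) k : k.-tuple 'I_n :=
  if k is l.+1 then cons_tuple (x l) (draws x l) else [tuple].

(** This is the falling factorial n (n - 1) ... (n - j + 1) times the Stirling number of the second
    kind S(k, j). *)
Definition num_draws n k j : nat := \sum_(t : k.-tuple 'I_n) (#|t| == j).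

Section counting.
Local Open Scope nat_scope.

Lemma sum_cons_tuple (T : finType) k (F : k.+1.-tuple T -> nat) :
  \sum_t F t = \sum_(t : k.-tuple T) \sum_c F (cons_tuple c t).
Proof.
rewrite pair_bigA/= (reindex (fun p : k.-tuple T * T => cons_tuple p.2 p.1))//.
exists (fun t => (behead_tuple t, thead t)) => [[t c]|t] _ /=.
  by rewrite theadE; congr (_, _); exact: val_inj.
by rewrite [RHS]tuple_eta; exact: val_inj.
Qed.

Variable n : nat.
Implicit Types (x y : nat -> 'I_n) (k j : nat).

Lemma card_cons_tuple k (c : 'I_n) (t : k.-tuple 'I_n) :
  #|cons_tuple c t| = (c \notin t) + #|t|.
Proof. by rewrite -cardU1; apply: eq_card => i; rewrite !inE. Qed.

Lemma card_notin k (t : k.-tuple 'I_n) : \sum_c (c \notin t) = n - #|t|.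
Proof.
rewrite -[X in X - _](card_ord n) -(cardC (mem t)) addKn -sum1_card.
by rewrite [RHS]big_mkcond/=; apply: eq_bigr => c _; rewrite !inE; case: (c \in t).
Qed.

Lemma card_in k (t : k.-tuple 'I_n) : \sum_(c : 'I_n) (c \in t) = #|t|.
Proof.
by rewrite -sum1_card [RHS]big_mkcond/=; apply: eq_bigr => c _; case: (c \in t).
Qed.

(** A word with j distinct letters misses n - j letters. The pairs counted are the outcomes in which
    the (j + 1)-st distinct coupon appears at draw k + 1. *)
Lemma num_draws_new k j :
  \sum_(t : k.-tuple 'I_n) \sum_c ((#|t| == j) && (c \notin t)) =
  (n - j) * num_draws n k j.
Proof.
rewrite /num_draws big_distrr/=; apply: eq_bigr => t _.
case: eqP => [<-|_]; last by rewrite muln0 big1.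
by rewrite muln1 -card_notin.
Qed.

(** The newest letter either repeats one of j + 1 letters already present or is one of the n - j
    letters missing so far. *)
Lemma num_drawsS k j : num_draws n k.+1 j.+1 =
  j.+1 * num_draws n k j.+1 + (n - j) * num_draws n k j.
Proof.
rewrite /num_draws sum_cons_tuple !big_distrr -big_split/=.
apply: eq_bigr => t _.
under eq_bigr do rewrite card_cons_tuple.
have [tj|tj] := eqVneq #|t| j.
  rewrite tj (ltn_eqF (ltnSn j)) muln0 muln1 add0n -tj -card_notin.
  by apply: eq_bigr => c _; case: (c \notin t); rewrite ?add0n ?add1n ?eqxx// ltn_eqF.
rewrite muln0 addn0; have [tj1|tj1] := eqVneq #|t| j.+1.
  rewrite muln1 -tj1 -card_in; apply: eq_bigr => c _.
  by case: (c \in t); rewrite /= ?add0n ?add1n ?eqxx// gtn_eqF.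
rewrite muln0 big1// => c _; case: (c \notin t).
  by rewrite add1n eqSS (negbTE tj).
by rewrite add0n (negbTE tj1).
Qed.

Lemma num_draws0 j : num_draws n 0 j = (j == 0).
Proof.
rewrite /num_draws (big_pred1 [tuple]); last by move=> t; apply/esym/eqP; exact: tuple0.
by rewrite eq_card0// eq_sym.
Qed.

Lemma num_drawsS0 k : num_draws n k.+1 0 = 0.
Proof.
rewrite /num_draws sum_cons_tuple big1// => t _; rewrite big1// => c _.
by apply/eqP; rewrite eqb0 -lt0n; apply/card_gt0P; exists c; rewrite inE eqxx.
Qed.

Lemma num_draws_gt k j : k < j -> num_draws n k j = 0.
Proof.
move=> kj; rewrite /num_draws big1// => t _; rewrite ltn_eqF//.
by apply: leq_ltn_trans kj; rewrite -{2}(size_tuple t) card_size.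
Qed.

(** Since ['I_n] may be empty, the empty word alone yields no sequence; [x] supplies one for k =
    0. *)
Lemma draws_surj x k (t : k.-tuple 'I_n) : exists y, draws y k = t.
Proof.
elim: k t => [|k IHk] t; first by exists x; exact/esym/tuple0.
have [y yt] := IHk (behead_tuple t).
exists (fun j => if j == k then thead t else y j).
have h l : l <= k -> draws (fun j => if j == k then thead t else y j) l = draws y l.
  by elim: l => [//|l IHl] lk /=; rewrite IHl ?(ltnW lk)// ltn_eqF.
by rewrite [RHS]tuple_eta; apply: val_inj; rewrite /= eqxx h// yt.
Qed.

Lemma draws_eq x y k : draws x k = draws y k <-> forall j, j < k -> x j = y j.
Proof.
elim: k => [|k IHk]; first by split.
split=> [/(congr1 val)/= [xy /val_inj/IHk IH] j|xy /=].
  by rewrite ltnS leq_eqVlt => /predU1P[->|/IH].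
by rewrite xy// (IHk.2 _)// => j jk; apply: xy; rewrite ltnW.
Qed.

Lemma drawsP x k i : reflect (exists2 j, j < k & x j = i) (i \in draws x k).
Proof.
apply: (iffP idP) => [|[j jk <-]].
  elim: k => [//|k IHk]; rewrite /= inE => /predU1P[->|/IHk[j jk <-]]; first by exists k.
  by exists j; rewrite // ltnW.
elim: k jk => [//|k IHk]; rewrite ltnS leq_eqVlt /= inE => /predU1P[->|/IHk ->].
  by rewrite eqxx.
by rewrite orbT.
Qed.

Lemma card_collected x k : #|collected x k| = #|draws x k|.
Proof.
apply: eq_card => i; apply/imsetP/drawsP => [[j _ ->]|[j jk <-]].
  by exists (val j) => //; exact: ltn_ord.
by exists (Ordinal jk).
Qed.

Lemma card_draws_mono x k l : k <= l -> #|draws x k| <= #|draws x l|.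
Proof.
move/subnK <-; elim: (l - k) => [//|i IHi]; rewrite addSn card_cons_tuple.
exact: leq_trans IHi (leq_addl _ _).
Qed.

(** Each draw adds at most one distinct coupon, so the count passes from r to r + 1 exactly at the
    first time. Taking [k.+1] on the left avoids the dummy value 0. *)
Lemma first_time_eq x r k : (first_time x r.+1 == k.+1) =
  (#|draws x k| == r) && (x k \notin draws x k).
Proof.
have cardS : #|draws x k.+1| = (x k \notin draws x k) + #|draws x k|.
  exact: card_cons_tuple.
rewrite /first_time; case: pselect => [h|nh].
  case: ex_minnP => m; rewrite card_collected => rm mmin.
  apply/eqP/andP => [mk|[/eqP dk xk]].
    move: rm; rewrite mk cardS => rk.
    have : #|draws x k| <= r.
      rewrite leqNgt; apply/negP => rk'.
      by have := mmin k; rewrite card_collected mk ltnn => /(_ rk').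
    move: rk; case: (x k \notin _) => /=; rewrite ?add1n ?add0n ?ltnS.
      by move=> r1 r2; rewrite eqn_leq r1 r2.
    by move=> r1 r2; have := leq_trans r1 r2; rewrite ltnn.
  apply/eqP; rewrite eqn_leq mmin ?card_collected ?cardS ?xk ?dk//=.
  rewrite ltnNge; apply/negP => /(card_draws_mono x); rewrite dk.
  by move/(leq_trans rm); rewrite ltnn.
apply/esym/negP => /andP[/eqP dk xk]; apply: nh; exists k.+1.
by rewrite card_collected cardS xk dk.
Qed.

End counting.

(** * The counting weights as convolutions of geometric weights *)

Section pmf.
Variables (R : realType) (n : nat).

(* The weight at k of the shifted waiting time for i + 1 (not i) coupons. *)
Definition coupon_pmf (i k : nat) : R :=
  ((n - i) * num_draws n (k + i) i)%N%:R / n%:R ^+ (k + i).+1.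

(** Divided by a power of n, the recursion [num_drawsS] becomes that of [conv_geometric] with
    [r = i.+1 / n]; thus each further coupon contributes one geometric factor. *)
Lemma coupon_pmfE i : (i < n)%N ->
  coupon_pmf i =1 geometric_sum_pmf (fun l => l%:R / n%:R) i.+1.
Proof.
move=> i_lt_n.
have n0 : (n%:R : R) != 0 by rewrite pnatr_eq0 -lt0n (leq_ltn_trans _ i_lt_n).
elim: i i_lt_n => [|i IHi] i_n.
  (* The first draw always gives a new coupon: the failure probability is 0 and the law is the point
     mass at 0. *)
  apply: conv_geometric => [|k]; rewrite /coupon_pmf !addn0 subn0.
    by rewrite num_draws0 muln1 expr1 divff// mul0r subr0 mul1r.
  by rewrite num_drawsS0 muln0 !mul0r subr0 mul1r add0r.
have nB j : (j <= n)%N -> 1 - j%:R / n%:R = (n - j)%N%:R / n%:R :> R.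
  by move=> jn; rewrite natrB// mulrBl divff.
move: (IHi (ltnW i_n)) => {}IHi.
rewrite [X in _ =1 X]/=.
apply: conv_geometric => [|k]; rewrite -/(geometric_sum_pmf _ i.+1) -IHi.
  rewrite /coupon_pmf !add0n num_drawsS num_draws_gt// muln0 add0n nB 1?ltnW//.
  by rewrite [_ ^+ i.+2]exprS !natrM; field; rewrite expf_neq0 n0.
rewrite /coupon_pmf nB 1?ltnW// !addSn !addnS num_drawsS !natrM natrD !natrM.
have E : n%:R ^+ (k + i).+3 = n%:R * n%:R ^+ (k + i).+2 :> R by exact: exprS.
have : (n%:R : R) ^+ (k + i).+2 != 0 by rewrite expf_neq0.
rewrite E; move: (_ ^+ _) (n - i.+1)%N => z b z0.
by field; rewrite z0 n0.
Qed.

End pmf.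

(** * The law of the waiting time on the probability space *)

Section coupon_probability.
Variables (R : realType) (d : measure_display) (T : measurableType d).
Variables (P : probability T R) (n : nat) (X : nat -> T -> 'I_n).
Hypothesis XP : coupon_draws P X.

Let path (w : T) (j : nat) : 'I_n := X j w.

Lemma measurable_prefix (A : nat -> set 'I_n) k :
  measurable [set w | forall j, (j < k)%N -> A j (X j w)].
Proof.
have [mX _ _] := XP; elim: k => [|k IHk].
  by rewrite [X in measurable X](_ : _ = setT)//; apply/seteqP; split.
rewrite [X in measurable X](_ : _ =
    [set w | forall j, (j < k)%N -> A j (X j w)] `&` X k @^-1` A k).
  exact: measurableI.
apply/seteqP; split=> w /=.
  by move=> h; split=> [j jk|]; apply: h; rewrite ?ltnS// ltnW.
by move=> [h hk] j; rewrite ltnS leq_eqVlt => /predU1P[->|/h].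
Qed.

(** Serves two purposes: singletons [A j] give the probability of a fixed word, and complements of a
    singleton give that of missing a coupon. *)
Lemma prob_prefix (A : nat -> set 'I_n) (p : R) k :
  (forall j, P (X j @^-1` A j) = p%:E) ->
  P [set w | forall j, (j < k)%N -> A j (X j w)] = (p ^+ k)%:E.
Proof.
move=> Ap; have [_ _ indep] := XP.
have := indep [fset j in iota 0 k]%fset A.
under eq_bigr do rewrite Ap.
rewrite [X in P X = _](_ : _ = [set w | forall j, (j < k)%N -> A j (X j w)]).
  move=> ->; rewrite prodEFin; congr EFin.
  rewrite big_const_seq count_predT iter_mulr_1.
  by rewrite card_fseq undup_id ?iota_uniq// size_iota.
apply/seteqP; split=> w /= h j.
  by move=> jk; apply: h; rewrite /= !inE mem_iota.
by rewrite /= !inE mem_iota/= add0n => jk; exact: h.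
Qed.

Lemma draws_prefixE (w0 : nat -> 'I_n) k : [set w | draws (path w) k = draws w0 k] =
  [set w | forall j, (j < k)%N -> [set w0 j] (X j w)].
Proof. by apply/seteqP; split=> w /= /draws_eq. Qed.

Lemma measurable_draws_eq k (t : k.-tuple 'I_n) :
  measurable [set w | draws (path w) k = t].
Proof.
(* A point [w] is needed to feed [draws_surj] with a sequence; if there is none, the event is
   empty. *)
have [->|/set0P[w _]] := eqVneq [set w | draws (path w) k = t] set0.
  exact: measurable0.
by have [y <-] := draws_surj (path w) t; rewrite draws_prefixE;
  exact: (@measurable_prefix (fun j => [set y j])).
Qed.

Lemma probability_inhabited : exists w : T, True.
Proof.
apply: contrapT => h.
have := probability_setT P; rewrite (_ : [set: T] = set0) ?measure0.
  by move=> /eqP; rewrite eqe eq_sym oner_eq0.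
by apply/seteqP; split=> w // _; apply: h; exists w.
Qed.

Lemma prob_draws_eq k (t : k.-tuple 'I_n) :
  P [set w | draws (path w) k = t] = (n%:R^-1 ^+ k)%:E.
Proof.
have [_ unifX _] := XP; have [w _] := probability_inhabited.
by have [y <-] := draws_surj (path w) t; rewrite draws_prefixE;
  apply: (@prob_prefix (fun j => [set y j])) => j.
Qed.

Lemma drawsE k (Q : pred (k.-tuple 'I_n)) : [set w | Q (draws (path w) k)] =
  \bigcup_(t in [set t | Q t]) [set w | draws (path w) k = t].
Proof.
by apply/seteqP; split=> w /= => [Qw|[t Qt ->//]]; exists (draws (path w) k).
Qed.

Lemma measurable_draws k (Q : pred (k.-tuple 'I_n)) :
  measurable [set w | Q (draws (path w) k)].
Proof.
rewrite drawsE; apply: fin_bigcup_measurable => // t _.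
exact: measurable_draws_eq.
Qed.

Lemma prob_draws k (Q : pred (k.-tuple 'I_n)) :
  P [set w | Q (draws (path w) k)] = ((\sum_t Q t)%N%:R / n%:R ^+ k)%:E.
Proof.
rewrite drawsE measure_fin_bigcup; last 3 first.
- exact: finite_finset.
- by move=> s t _ _ [w [/= <- <-]].
- by move=> t _; exact: measurable_draws_eq.
rewrite (@fsbigE _ _ _ _ _ (enum Q)) ?enum_uniq//=; first last.
- by move=> t /= Qt; rewrite mem_enum => /negP; case.
- by move=> t /=; rewrite mem_enum.
rewrite [LHS](eq_bigr (fun=> (n%:R^-1 ^+ k)%:E)); last by move=> t _; exact: prob_draws_eq.
rewrite sumEFin -big_mkcond/= big_enum_cond/=.
rewrite (eq_bigl Q) => [|t]; last by rewrite mem_setE andbb.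
by congr EFin; rewrite sumr_const sum1_card exprVn -[LHS]mulr_natl.
Qed.

Variables (m i : nat).
Hypothesis mi : (n - m)%N = i.+1.

(** Expresses the event through the first k + 1 draws alone, so that counting words gives its
    probability; the head of the tuple is the newest draw. *)
Lemma waiting_time_draws k : [set w | waiting_time X m w = k.+1] =
  [set w | let t := draws (path w) k.+1 in
           (#|behead_tuple t| == i) && (thead t \notin behead_tuple t)].
Proof.
have E w : (waiting_time X m w == k.+1) =
    (#|draws (path w) k| == i) && (path w k \notin draws (path w) k).
  by rewrite /waiting_time mi first_time_eq.
apply/seteqP; split=> w /=; rewrite theadE; first by move=> /eqP; rewrite E.
by move=> h; apply/eqP; rewrite E.
Qed.

Lemma prob_waiting_time k : P [set w | waiting_time X m w = k.+1] =
  (((n - i) * num_draws n k i)%N%:R / n%:R ^+ k.+1)%:E.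
Proof.
rewrite waiting_time_draws.
rewrite (prob_draws (fun t =>
  (#|behead_tuple t| == i) && (thead t \notin behead_tuple t))).
by rewrite sum_cons_tuple -num_draws_new.
Qed.

Lemma measurable_waiting_time k : measurable [set w | waiting_time X m w = k].
Proof.
have mS l : measurable [set w | waiting_time X m w = l.+1].
  rewrite waiting_time_draws.
  exact: (measurable_draws (fun t =>
    (#|behead_tuple t| == i) && (thead t \notin behead_tuple t))).
case: k => [|k]; last exact: mS.
(* The dummy value 0 is not decided by finitely many draws, so its event is reached through the
   complement. *)
rewrite [X in measurable X](_ : _ = ~` \bigcup_l [set w | waiting_time X m w = l.+1]).
  by apply: measurableC; exact: bigcup_measurable.
apply/seteqP; split=> w /= => [w0 [l _ /=]|h]; first by rewrite w0.
by case E : waiting_time => [//|l]; exfalso; apply: h; exists l.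
Qed.

Lemma measurable_shifted_waiting_time :
  measurable_fun [set: T] (shifted_waiting_time X m).
Proof.
move=> _ Y _; rewrite setTI.
rewrite [X in measurable X](_ : _ =
    \bigcup_(k in [set k | Y (k - (n - m))%N]) [set w | waiting_time X m w = k]).
  by apply: bigcup_measurable => k _; exact: measurable_waiting_time.
apply/seteqP; split=> w /= => [Yw|[k Yk wk]].
  by exists (waiting_time X m w).
by rewrite /shifted_waiting_time wk.
Qed.

Hypothesis i_lt_n : (i < n)%N.

Lemma prob_avoid (c : 'I_n) k :
  P [set w | forall j, (j < k)%N -> (~` [set c]) (X j w)] = ((1 - n%:R^-1) ^+ k)%:E.
Proof.
have [mX unifX _] := XP; apply: (@prob_prefix (fun=> ~` [set c])) => j.
by rewrite -[X in P X]/(~` (X j @^-1` [set c])) probability_setC// unifX.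
Qed.

(** If the collection is never completed, then for every k some coupon is missing from the first k
    draws. The union bound gives at most n (1 - 1/n)^k, which tends to 0. *)
Lemma waiting_time0 : P [set w | waiting_time X m w = 0%N] = 0%E.
Proof.
have n0 : 0 < n%:R :> R by rewrite ltr0n (leq_ltn_trans _ i_lt_n).
pose q : R := 1 - n%:R^-1.
have q0 : 0 <= q by rewrite subr_ge0 invf_le1// ler1n (leq_ltn_trans _ i_lt_n).
have Pk k : (P [set w | waiting_time X m w = 0%N] <= (n%:R * q ^+ k)%:E)%E.
  pose A c := [set w | forall j, (j < k)%N -> (~` [set c]) (X j w)].
  have := @content_sub_fsum _ _ _ P 'I_n setT [set w | waiting_time X m w = 0%N] A.
  rewrite (@fsbigE _ _ _ _ _ (enum 'I_n)) ?enum_uniq//=; last first.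
    by move=> c _; rewrite mem_enum.
  move=> /(_ _ _ (measurable_waiting_time 0)) h.
  apply: (le_trans (h _ _ _)).
  - exact: finite_finset.
  - by move=> c _; exact: (@measurable_prefix (fun=> ~` [set c])).
  - move=> w /= w0.
    have /existsP[c cD] : [exists c, c \notin draws (path w) k].
      rewrite -negb_forall; apply/negP => /forallP inD.
      move: w0; rewrite /waiting_time mi /first_time; case: pselect => [h'|[]].
        case: ex_minnP => -[|l] //.
        by rewrite card_collected eq_card0.
      exists k; rewrite card_collected (eq_card (B := 'I_n)) ?card_ord//.
    by exists c => // j jk /= Xc; move/negP: cD; apply; apply/drawsP; exists j.
  rewrite [leLHS](eq_bigr (fun=> (q ^+ k)%:E)); last by move=> c _; exact: prob_avoid.
  rewrite sumEFin lee_fin big_enum_cond/= (eq_bigl (mem 'I_n)) => [|c]; last first.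
    by rewrite mem_set// andbT.
  by rewrite sumr_const card_ord mulr_natl.
apply/eqP; rewrite -measure_le0.
have qk : (fun k => n%:R * q ^+ k) @ \oo --> n%:R * (0 : R).
  by apply: cvgMr; apply: cvg_expr; rewrite ger0_norm// /q ltrBlDr ltrDl invr_gt0.
rewrite -(fineK (fin_num_measure P _ (measurable_waiting_time 0))) lee_fin.
rewrite -(mulr0 n%:R); apply: (cvgr_to_ge qk); apply: nearW => k.
by rewrite -lee_fin fineK ?fin_num_measure//; exact: measurable_waiting_time.
Qed.

Lemma prob_shifted_waiting_time k :
  P (shifted_waiting_time X m @^-1` [set k]) = (coupon_pmf R n i k)%:E.
Proof.
rewrite /coupon_pmf -prob_waiting_time; case: k => [|k]; last first.
  congr (P _); apply/seteqP; split=> w /=; rewrite /shifted_waiting_time mi; lia.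
(* Truncated subtraction sends every value up to i + 1 to 0. The values below i + 1 are null: 0 is
   the dummy, and fewer than i + 1 draws cannot show i + 1 coupons. *)
rewrite add0n [X in P X](_ : _ = [set w | waiting_time X m w = i.+1] `|`
    [set w | (waiting_time X m w < i.+1)%N]); last first.
  apply/seteqP; split=> w /=; rewrite /shifted_waiting_time mi.
    by move=> /eqP; rewrite subn_eq0 leq_eqVlt => /predU1P.
  by move=> [->|/ltnW h]; apply/eqP; rewrite subn_eq0.
have E : [set w | (waiting_time X m w < i.+1)%N] =
    \bigcup_(j in `I_i.+1) [set w | waiting_time X m w = j].
  by apply/seteqP; split=> w /= => [h|[j ji ->]//]; exists (waiting_time X m w).
have mS k : measurable [set w | waiting_time X m w = k] by exact: measurable_waiting_time.
rewrite measureU0//; first by rewrite E; exact: bigcup_measurable.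
rewrite E measure_fin_bigcup//; last by move=> k l _ _ [w [/= <- <-]].
apply: fsbig1 => -[|j] /= ji; first exact: waiting_time0.
by rewrite prob_waiting_time num_draws_gt// muln0 mul0r.
Qed.

End coupon_probability.

(** * The explicit bounds, after the substitution i = n - l *)

Lemma big_nat_subn (T : Type) (idx : T) (op : Monoid.com_law idx) (F : nat -> T) m n :
  \big[op/idx]_(m.+1 <= i < n.+1) F i = \big[op/idx]_(l < n - m) F (n - l)%N.
Proof.
rewrite big_nat_rev/= -[X in \big[_/_]_(X <= _ < _) _]add0n big_addn subSS big_mkord.
by apply: eq_bigr => l _; congr F; have := ltn_ord l; lia.
Qed.

Section bounds.
Variables (R : realType) (n m : nat).
Hypothesis mn : (m < n)%N.

Let r (l : nat) : R := l%:R / n%:R.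

Let r01 l : (l < n - m)%N -> 0 <= r l <= 1.
Proof.
move=> lnm; have n0 : 0 < n%:R :> R by rewrite ltr0n (leq_ltn_trans _ mn).
by rewrite divr_ge0//= ler_pdivrMr// mul1r ler_nat; lia.
Qed.

Let subr_n l : (l < n - m)%N -> (n - l)%N%:R / n%:R = 1 - r l.
Proof.
move=> lnm; have n0 : n%:R != 0 :> R by rewrite pnatr_eq0; lia.
by rewrite natrB ?mulrBl ?divff//; lia.
Qed.

Lemma lambda_E : lambda_ R n m = \sum_(l < n - m) l%:R / n%:R.
Proof.
rewrite /lambda_ big_nat_subn; apply: eq_bigr => l _.
by rewrite subr_n// opprB addrC subrK.
Qed.

Lemma sum_sqE : sum_sq R n m = \sum_(l < n - m) (l%:R / n%:R) ^+ 2.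
Proof.
rewrite /sum_sq big_nat_subn; apply: eq_bigr => l _.
by rewrite subr_n// opprB addrC subrK.
Qed.

Lemma prod_ratioE : \prod_(m.+1 <= i < n.+1) (i%:R / n%:R) =
  \prod_(l < n - m) (1 - l%:R / n%:R) :> R.
Proof. by rewrite big_nat_subn; apply: eq_bigr => l _; rewrite subr_n. Qed.

Lemma sum_sq_ge0 : 0 <= sum_sq R n m.
Proof. by apply: sumr_ge0 => i _; exact: sqr_ge0. Qed.

Lemma lambda_ge0 : 0 <= lambda_ R n m.
Proof. by rewrite lambda_E; apply: sumr_ge0 => l _; have /andP[] := r01 (ltn_ord l). Qed.

Lemma poisson_error_bounds (d : measure_display) (T : measurableType d)
    (P : probability T R) (X : nat -> T -> 'I_n) : coupon_draws P X ->
  1 / 5 * (\prod_(m.+1 <= i < n.+1) (i%:R / n%:R)) * sum_sq R n m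
    <= poisson_error P X m <= 2 * sum_sq R n m.
Proof.
move=> XP; have [i mi] : exists i, (n - m)%N = i.+1.
  by exists (n - m).-1; lia.
have i_lt_n : (i < n)%N by lia.
pose f := shifted_waiting_time X m.
have mf : measurable_fun [set: T] f := measurable_shifted_waiting_time XP mi.
(* Bundling [f] with its measurability makes its pushforward a probability measure, as the bounds on
   [dTV] require. *)
pose W : {mfun T >-> nat} := HB.pack f (isMeasurableFun.Build _ _ _ _ f mf).
have muE k : distribution P W [set k] = (geometric_sum_pmf r (n - m) k)%:E.
  by rewrite mi -coupon_pmfE//; exact: (prob_shifted_waiting_time XP mi i_lt_n k).
have nuE k := poisson_prob1 k lambda_ge0.
apply/andP; split.
  have := ler_dTV (distribution P W) (poisson_prob (lambda_ R n m) 0) [set 0%N].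
  rewrite /= muE nuE/= => /(le_trans _); apply.
  rewrite geometric_sum_pmf0 prod_ratioE /poisson_weight expr0 fact0 divr1 mul1r.
  have := prod_expRN_ge r01; rewrite lambda_E sum_sqE; lra.
apply: (@dTV_le _ (distribution P W) (poisson_prob (lambda_ R n m) 0)) => K.
rewrite big_mkord; under eq_bigr do rewrite /= muE nuE/= lambda_E.
by rewrite sum_sqE; exact: poisson_geometric_sum_excess.
Qed.

End bounds.

(** * The order of the error along the sequence *)

Lemma prod_one_sub_ge (R : realType) (N : nat) (rs : nat -> R) (B : R) :
  (forall l, (l < N)%N -> 0 <= rs l <= 1 / 2) -> \sum_(l < N) rs l <= B ->
  expR (- (2 * B)) <= \prod_(l < N) (1 - rs l).
Proof.
move=> rs12 sB; apply: (@le_trans _ _ (expR (- (2 * \sum_(l < N) rs l)))).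
  by rewrite ler_expR; lra.
elim: N rs12 {sB} => [|N IHN] rs12; first by rewrite !big_ord0 mulr0 oppr0 expR0.
rewrite !big_ord_recr/= mulrDr opprD expRD.
apply: ler_pM; rewrite ?expR_ge0//; first by apply: IHN => l lN; apply: rs12; exact: ltnW.
have /andP[r0 r1] := rs12 N (ltnSn _).
(* On [0, 1/2] one has [(1 - x) * (1 + 2 * x) >= 1], hence [1 - x] is at least exp(-2x). *)
have e2r := expR_ge1Dx (2 * rs N).
by rewrite expRN -[leLHS]mul1r ler_pdivrMr ?expR_gt0//; nra.
Qed.

Theorem corollary5p2p1 (R : realType) (lambda : R) (m : nat -> nat)
    (lambda_gt0 : 0 < lambda)
    (m_lt : forall n : nat, (2 <= n)%N -> (m n < n)%N)
    (m_oo : m @ \oo --> \oo)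
    (m_sqrt : (fun n : nat => (n%:R - (m n)%:R) / Num.sqrt (n%:R : R)) @ \oo
                --> Num.sqrt (2 * lambda)) :
  (exists c C : R, [/\ 0 < c, 0 < C &
    \forall n \near \oo,
      forall (d : measure_display) (T : measurableType d)
        (P : probability T R) (X : nat -> T -> 'I_n),
      coupon_draws P X ->
      c * sum_sq R n (m n) <= poisson_error P X (m n) <= C * sum_sq R n (m n)])
  /\
  (forall n : nat, (2 <= n)%N ->
    (forall i : nat, (m n < i <= n)%N -> 3 / 4 <= i%:R / n%:R :> R) ->
    forall (d : measure_display) (T : measurableType d)
      (P : probability T R) (X : nat -> T -> 'I_n),
    coupon_draws P X ->
    1 / 5 * (\prod_((m n).+1 <= i < n.+1) (i%:R / n%:R)) * sum_sq R n (m n)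
      <= poisson_error P X (m n) <= 2 * sum_sq R n (m n)).
Proof.
split; last first.
  by move=> n n2 _ d T P X; apply: poisson_error_bounds; exact: m_lt.
(* (n - m)^2 / n tends to [2 * lambda], so it is eventually below [B]. It also bounds the sum of the
   l / n, so the product in the lower bound is at least exp(-2B). *)
pose B : R := 2 * lambda + 1.
exists (1 / 5 * expR (- (2 * B))), 2.
rewrite mulr_gt0 ?expR_gt0 ?divr_gt0//.
split=> //.
have sq_lt : \forall n \near \oo,
    ((n%:R - (m n)%:R) / Num.sqrt n%:R) * ((n%:R - (m n)%:R) / Num.sqrt n%:R) < B.
  apply: (cvgr_lt _ (cvgM m_sqrt m_sqrt)).
  by rewrite -expr2 sqr_sqrtr ?ltrDl// mulr_ge0// ltW.
near=> n => d T P X XP.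
have n2 : (2 <= n)%N by near: n; exact: nbhs_infty_ge.
(* Then ((n - m) / n)^2 <= B / n <= 1/4, so that every l / n is at most 1/2, as [prod_one_sub_ge]
   demands. *)
have n4B : 4 * B <= n%:R by near: n; exact: nbhs_infty_ger.
have mn := m_lt _ n2.
have n0 : 0 < n%:R :> R by rewrite ltr0n; lia.
have NB : (n - m n)%N%:R ^+ 2 / n%:R <= B.
  apply: ltW; rewrite -(sqr_sqrtr (ltW n0)) -expr_div_n natrB ?(ltnW mn)// expr2.
  by near: n; exact: sq_lt.
have /andP[lo hi] := poisson_error_bounds mn XP.
rewrite hi andbT; apply: le_trans lo.
rewrite ler_wpM2r ?sum_sq_ge0// ler_wpM2l// ?divr_ge0// prod_ratioE//.
have N0 : 0 <= (n - m n)%N%:R / n%:R :> R by rewrite divr_ge0.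
have lN (l : nat) : (l < n - m n)%N -> 0 <= (l%:R / n%:R : R) <= (n - m n)%N%:R / n%:R.
  by move=> l_N; rewrite divr_ge0//= ler_pM2r ?invr_gt0// ler_nat ltnW.
apply: (@prod_one_sub_ge _ _ (fun l => l%:R / n%:R)) => [l /lN/andP[-> /le_trans ->//]|].
  set x := _ / _.
  have : x ^+ 2 <= 1 / 4.
    have -> : x ^+ 2 = (n - m n)%N%:R ^+ 2 / n%:R / n%:R.
      by rewrite /x expr_div_n expr2 invfM mulrA.
    by rewrite ler_pdivrMr//; lra.
  have x0 : 0 <= x by [].
  by clearbody x; move: x0; nra.
apply: le_trans NB.
apply: (@le_trans _ _ (\sum_(l < n - m n) (n - m n)%N%:R / n%:R)).
  by apply: ler_sum => l _; have /andP[] := lN l (ltn_ord l).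
by rewrite sumr_const card_ord -[leLHS]mulr_natl expr2 mulrA.
Unshelve. all: by end_near.
Qed.
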